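(* With $B(n)$ and $B'(n)$ as defined in the context: (a) $$\sum_{n\ge1}B(n)q^n=\frac{2q(-q^2;q)_\infty(-q^4;q)_\infty}{(q^2;q^4)_\infty(q^6;q^4)_\infty}-\frac{q}{(1+q)(1+q^3)}=\frac{2q(-q^2;q)_\infty(-q^4;q)_\infty}{(q^2;q^4)_\infty(q^6;q^4)_\infty}+\sum_{n\ge1}(-1)^n\left\lfloor\frac{n+2}{3}\right\rfloor q^n;$$ (b) $$\sum_{n\ge1}B'(n)q^n=\frac{q}{(1-q)(1-q^3)}=\sum_{n\ge1}\left\lfloor\frac{n+2}{3}\right\rfloor q^n.$$
   Context: $(a;q)_\infty=\prod_{j\ge0}(1-aq^j)$, $|q|<1$. A two-color partition is a partition whose parts are each colored blue or green (the same integer may occur in both colors). For a positive integer $n$, $B(n)$ is the number of two-color partitions of $n$ in which: the smallest part $s$ is odd and blue, every other blue odd part is at least $s+2$, and every blue even part is at least $s+4$; no even integer occurs more than once in the same color (odd parts may repeat). $B_0(n)$ (resp. $B_1(n)$) is the number of partitions counted by $B(n)$ whose total number of even parts is even (resp. odd), and $B'(n)=B_0(n)-B_1(n)$. Equivalently, $\sum_{n\ge1}B(n)q^n=\sum_{n\ge0}q^{2n+1}\frac{(-q^{2n+6};q^2)_\infty(-q^{2n+2};q^2)_\infty}{(q^{2n+3};q^2)_\infty(q^{2n+1};q^2)_\infty}$ and $\sum_{n\ge1}B'(n)q^n=\sum_{n\ge0}q^{2n+1}\frac{(q^{2n+6};q^2)_\infty(q^{2n+2};q^2)_\infty}{(q^{2n+3};q^2)_\infty(q^{2n+1};q^2)_\infty}$.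 *)

(* Defs.v *)
From HB Require Import structures.
From mathcomp Require Import all_boot all_order all_algebra.
From mathcomp Require Export complex.
From mathcomp Require Import all_classical all_reals all_analysis.
Import Order.TTheory GRing.Theory Num.Theory numFieldNormedType.Exports.

Set Implicit Arguments.
Unset Strict Implicit.
Unset Printing Implicit Defensive.

Definition color := bool.
Definition blue : color := true.
Definition green : color := false.

(* A two-color partition of n is encoded by its multiplicities: f (c, i) is the
   number of parts of color c equal to i. A part of a partition of n is at most
   n and occurs at most n times, so the bounds on i and f (c, i) lose nothing.
   The index i = 0 is present in 'I_n.+1 but is not allowed as a part. *)
Definition colmult (n : nat) := {ffun color * 'I_n.+1 -> 'I_n.+1}.

Definition two_color_partition (n : nat) (f : colmult n) : bool :=
  [forall c : color, f (c, ord0) == 0 :> nat] &&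
  (\sum_(c : color) \sum_(i < n.+1) f (c, i) * i == n).

(* "Every other blue odd part" means every blue odd part of the multiset left
   after removing one blue copy of s; the blue part i occurs there
   f (blue, i) - (i == s) times. In particular s is a blue part only once. *)
Definition B_admissible (n : nat) (f : colmult n) : bool :=
  [exists s : 'I_n.+1,
    [&& odd s, 0 < f (blue, s),
        [forall c : color, forall i : 'I_n.+1, (0 < f (c, i)) ==> (s <= i)],
        [forall i : 'I_n.+1,
           odd i && (0 < f (blue, i) - (i == s)) ==> (s + 2 <= i)]
      & [forall i : 'I_n.+1,
           ~~ odd i && (0 < f (blue, i)) ==> (s + 4 <= i)]]] &&
  [forall c : color, forall i : 'I_n.+1, ~~ odd i ==> (f (c, i) <= 1)].

Definition num_even_parts (n : nat) (f : colmult n) : nat :=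
  \sum_(c : color) \sum_(i < n.+1 | ~~ odd i) f (c, i).

Definition B (n : nat) : nat :=
  #|[set f : colmult n | two_color_partition f && B_admissible f]|.

Definition B0 (n : nat) : nat :=
  #|[set f : colmult n | [&& two_color_partition f, B_admissible f
                           & ~~ odd (num_even_parts f)]]|.

Definition B1 (n : nat) : nat :=
  #|[set f : colmult n | [&& two_color_partition f, B_admissible f
                           & odd (num_even_parts f)]]|.

Local Open Scope ring_scope.
Local Open Scope classical_set_scope.

Definition B' (n : nat) : int := (B0 n)%:Z - (B1 n)%:Z.

Definition qpoch (K : numFieldType) (a q : K) : K :=
  lim ((fun N : nat => \prod_(j < N) (1 - a * q ^+ j)) @ \oo).

Definition sums_from1 (K : numFieldType) (u : nat -> K) (l : K) : Prop :=
  (fun N : nat => \sum_(1 <= n < N.+1) u n) @ \oo --> l.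

(* Main.v *)
(* Weight each admissible partition by w^(number of even parts), w = 1 or -1.
   With x = q^(2n), the n-th term of the generating function is
     q x (-wxq^2; q^2) (-wxq^6; q^2) / ((xq; q^2) (xq^3; q^2))
       = w q (U(x) - U(xq^2)) / ((1 + wq) (1 + wq^3)),
     U(x) = (-wx; q^2) (-wxq^4; q^2) / ((xq; q^2) (xq^3; q^2)),
   because (1 + wx) (1 + wxq^4) - (1 - xq) (1 - xq^3) = wx (1 + wq) (1 + wq^3)
   when w^2 = 1. The sum is w q (U(1) - 1) / ((1 + wq) (1 + wq^3)), and U(1) = 0
   for w = -1.
   To get convergence of the counting series, the telescoping is carried out with
   parts at most 2N. The error made by truncating parts, multiplicities and weight
   is dominated by the same error at r = |q|, w = 1, where all terms are
   nonnegative and a sandwich argument applies. *)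
Require Import Defs.
From mathcomp Require Import all_boot all_order all_algebra.
From mathcomp Require Import complex.
From mathcomp Require Import all_classical all_reals all_analysis.
From mathcomp Require Import zify ring lra.
Import Order.TTheory GRing.Theory Num.Theory numFieldNormedType.Exports.
Local Open Scope ring_scope.
Local Open Scope complex_scope.
Local Open Scope classical_set_scope.

Set Implicit Arguments.
Unset Strict Implicit.
Unset Printing Implicit Defensive.

(** * Admissible multiplicity functions *)

(** Extension by zero beyond the box, so that functions living in boxes of different sizes can be
    compared pointwise. *)
Definition mult n (f : colmult n) (c : color) (i : nat) : nat :=
  if (i <= n)%N then f (c, inord i) : nat else 0.

Definition weight n (f : colmult n) : nat :=
  (\sum_(c : color) \sum_(i < n.+1) f (c, i) * i)%N.

(** The weight is left free: everything that fits in the box is summed first, and [weight] selects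
    the integer being partitioned afterwards. *)
Definition admissible n (f : colmult n) : bool :=
  [forall c : color, f (c, ord0) == 0 :> nat] && B_admissible f.

(* [allowed s c i m]: an admissible partition with smallest part [s] may contain
   the part [i] in color [c] exactly [m] times. *)
Definition allowed (s : nat) (c : color) (i m : nat) : bool :=
  if (i < s)%N then m == 0
  else if i == s then c ==> (m == 1)
  else odd i || (if c && (i < s + 4)%N then m == 0 else (m <= 1)%N).

Lemma mult_ord n (f : colmult n) c (i : 'I_n.+1) : mult f c i = f (c, i).
Proof. by rewrite /mult -ltnS ltn_ord inord_val. Qed.

Lemma mult_inj n (f g : colmult n) : mult f =2 mult g -> f = g.
Proof.
by move=> fg; apply/ffunP => -[c i]; apply/ord_inj; rewrite -!mult_ord fg.
Qed.

Lemma mult_gt n (f : colmult n) c i : (n < i)%N -> mult f c i = 0%N.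
Proof. by move=> ni; rewrite /mult leqNgt ni. Qed.

Lemma sum_mult n (f : colmult n) (w : nat -> nat) (P : pred nat) c L : (n < L)%N ->
  (\sum_(i < n.+1 | P i) f (c, i) * w i = \sum_(0 <= i < L | P i) mult f c i * w i)%N.
Proof.
move=> nL; rewrite (big_cat_nat (leq0n _) nL)/= [X in (_ + X)%N]big1_seq ?addn0.
  by rewrite big_mkord; apply: eq_bigr => i _; rewrite mult_ord.
by move=> i /andP[_]; rewrite mem_index_iota => /andP[ni _]; rewrite mult_gt.
Qed.

(** Once [s] is fixed, every condition concerns one color and one size at a time; this is what lets
    the generating function factor. Blue [s] occurs exactly once because a second copy would be a
    blue odd part below [s + 2]. *)
Lemma admissibleP n (f : colmult n) :
  admissible f <-> exists s, odd s /\ forall c i, allowed s c i (mult f c i).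
Proof.
split.
  case/andP => /forallP f0 /andP[/existsP[s /and5P[os fs /forallP h1 /forallP h2 /forallP h3]]
    /forallP h4].
  exists s; split=> // c i; rewrite /allowed; have sn := ltn_ord s.
  case: (leqP i n) => [ile|ni]; last by rewrite (mult_gt f c ni); case: ltnP => //;
    case: eqP => [|_ _]; [lia|case: odd => //; case: ifP].
  have [{ile}j ->] : exists j : 'I_n.+1, i = j by exists (Ordinal (ile : (i < n.+1)%N)).
  have /forallP/(_ j) := h1 c; have := h2 j; have := h3 j.
  have /forallP/(_ j) := h4 c; rewrite mult_ord.
  move: fs; rewrite /blue.
  have [-> {j}|js] := eqVneq j s.
    rewrite os eqxx ltnn /=; case: c => //=.
    by move: (nat_of_ord (f (true, s))) => a; case: ltnP => /=; lia.
  have {}js : (j == s :> nat) = false by apply/eqP => /val_inj/eqP; rewrite (negbTE js).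
  rewrite js; case: c => /=; move: (nat_of_ord (f (true, j))) => a.
    by move: (nat_of_ord j) (nat_of_ord s) js => j' s' js; case: (odd j') => /=;
      do ![case: ifP]; lia.
  move: (nat_of_ord (f (false, j))) => b.
  by move: (nat_of_ord j) (nat_of_ord s) js => j' s' js; case: (odd j') => /=; do ![case: ifP]; lia.
case=> s [os H]; apply/andP; split.
  apply/forallP => c; have := H c 0%N; rewrite (mult_ord f c ord0) /allowed.
  by case: s os {H}.
(* Blue [s] has multiplicity 1, whereas multiplicities beyond the box vanish. *)
have sn : (s <= n)%N.
  rewrite leqNgt; apply/negP => /(mult_gt f true) f0.
  by have := H true s; rewrite f0 /allowed ltnn eqxx.
apply/andP; split; last first.
  apply/forallP => c; apply/forallP => i; apply/implyP => oi.
  have := H c i; rewrite mult_ord /allowed (negbTE oi) /=.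
  case: ifP => [_ /eqP->//|_]; case: eqP => [E|_]; first by rewrite E os in oi.
  by case: ifP => // _ /eqP->.
apply/existsP; exists (Ordinal (sn : (s < n.+1)%N)); apply/and5P; split => //=.
- by have := H true s; rewrite (mult_ord f true (Ordinal (sn : (s < n.+1)%N))) /allowed ltnn
  eqxx /= => /eqP->.
- apply/forallP => c; apply/forallP => i; have := H c i; rewrite mult_ord /allowed.
  by case: ltnP => [_ /eqP-> //|_ _]; rewrite implybT.
- apply/forallP => i; have := H true i; rewrite mult_ord /allowed /blue.
  rewrite -val_eqE /=; case: ltnP => [_ /eqP-> //|]; first by rewrite sub0n andbF.
  case: eqP => [-> _ /= /eqP->|]; first by rewrite subnn andbF.
  move=> /eqP; case: (boolP (odd i)) => //= oi; lia.
- apply/forallP => i; have := H true i; rewrite mult_ord /allowed /blue.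
  case: ltnP => [_ /eqP-> //|_]; first by rewrite andbF.
  case: eqP => [->|_]; first by rewrite os.
  case: (boolP (odd i)) => //= oi.
  by case: ltnP => [_ /eqP->//|_ _]; rewrite implybT.
Qed.

(** * Moving partitions between boxes of different sizes *)

Definition resize m n (f : colmult m) : colmult n :=
  [ffun x : color * 'I_n.+1 => inord (mult f x.1 x.2)].

Lemma mult_resize m n (f : colmult m) :
  (forall c i, (n < i)%N -> mult f c i = 0%N) ->
  (forall c i, (mult f c i <= n)%N) -> mult (resize n f) =2 mult f.
Proof.
move=> f0 fn c i; case: (leqP i n) => [ile|ilt]; last by rewrite f0 // mult_gt.
have -> : i = Ordinal (ile : (i < n.+1)%N) by [].
by rewrite mult_ord ffunE /= inordK // ltnS.
Qed.

Lemma mult_resize_widen m n (f : colmult m) :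
  (m <= n)%N -> mult (resize n f) =2 mult f.
Proof.
move=> mn; apply: mult_resize => c i; first by move=> /(leq_ltn_trans mn) mi; rewrite mult_gt.
by rewrite /mult; case: ifP => // _; apply: leq_trans mn; rewrite -ltnS.
Qed.

Lemma resizeK m n : (m <= n)%N -> cancel (@resize m n) (@resize n m).
Proof.
move=> mn f; apply: mult_inj => c i; rewrite mult_resize ?mult_resize_widen //.
  by move=> d j mj; rewrite mult_resize_widen // mult_gt.
move=> d j; rewrite mult_resize_widen //.
by rewrite /mult; case: ifP => // _; rewrite -ltnS.
Qed.

Section MultCongr.
Variables (m n : nat) (f : colmult m) (g : colmult n).
Hypothesis fg : mult f =2 mult g.

Lemma admissible_congr : admissible f = admissible g.
Proof.
by apply/idP/idP => /admissibleP[s [os H]]; apply/admissibleP; exists s; split=> // c i;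
  rewrite ?fg // -fg.
Qed.

Lemma sum_congr (w : nat -> nat) (P : pred nat) :
  (\sum_(c : color) \sum_(i < m.+1 | P i) f (c, i) * w i =
   \sum_(c : color) \sum_(i < n.+1 | P i) g (c, i) * w i)%N.
Proof.
apply: eq_bigr => c _.
rewrite (sum_mult f w P c (leq_maxl m.+1 n.+1)) (sum_mult g w P c (leq_maxr m.+1 n.+1)).
by apply: eq_bigr => i _; rewrite fg.
Qed.

Lemma weight_congr : weight f = weight g.
Proof. exact: (sum_congr id predT). Qed.

Lemma num_even_parts_congr : num_even_parts f = num_even_parts g.
Proof.
have := sum_congr (fun=> 1%N) (fun i => ~~ odd i).
by under eq_bigr do under eq_bigr do rewrite muln1;
   under [RHS]eq_bigr do under eq_bigr do rewrite muln1.
Qed.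

End MultCongr.

Lemma mult_le_weight n (f : colmult n) c i : (mult f c i * i <= weight f)%N.
Proof.
case: (leqP i n) => [ile|ni]; last by rewrite mult_gt.
have -> : i = Ordinal (ile : (i < n.+1)%N) by [].
rewrite mult_ord /weight (bigD1 c) //= (bigD1 (Ordinal (ile : (i < n.+1)%N))) //=.
by rewrite -addnA leq_addr.
Qed.

Lemma admissible_mult0 n (f : colmult n) c : admissible f -> mult f c 0 = 0%N.
Proof. by case/andP => /forallP/(_ c)/eqP f0 _; rewrite (mult_ord f c ord0). Qed.

(** Weight at most [m] bounds every positive part and its multiplicity by [m]. The index 0 adds no
    weight; there admissibility forces multiplicity 0. *)
Lemma resize_narrowK m n (g : colmult n) : (m <= n)%N ->
  admissible g -> (weight g <= m)%N -> resize n (resize m g) = g.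
Proof.
move=> mn ag gm; apply: mult_inj => c i; rewrite mult_resize_widen // mult_resize //.
  move=> d [//|j] mj; have := mult_le_weight g d j.+1; case: (mult g d j.+1) => // k.
  by move: gm mj; nia.
move=> d [|j]; first by rewrite admissible_mult0.
by have := mult_le_weight g d j.+1; move: gm; nia.
Qed.

Lemma sum_admissible_resize (K : comNzRingType) (w : K) m n k : (k <= m <= n)%N ->
  \sum_(f : colmult m | admissible f && (weight f == k)) w ^+ num_even_parts f =
  \sum_(f : colmult n | admissible f && (weight f == k)) w ^+ num_even_parts f.
Proof.
case/andP => km mn.
rewrite [RHS](reindex_onto (@resize m n) (@resize n m)) => [|g /andP[ag /eqP gk]]; last first.
  by rewrite resize_narrowK // gk.
apply: eq_big => [f|f _].
  have E := mult_resize_widen f mn.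
  by rewrite (admissible_congr E) (weight_congr E) resizeK // eqxx andbT.
by rewrite (num_even_parts_congr (mult_resize_widen f mn)).
Qed.

(** Widening is injective and keeps the weight. Since [k] may exceed [m], the smaller box may miss
    partitions of [k], hence only an inequality. *)
Lemma card_admissible_resize m n k : (m <= n)%N ->
  (#|[pred f : colmult m | admissible f && (weight f == k)]| <=
   #|[pred f : colmult n | admissible f && (weight f == k)]|)%N.
Proof.
move=> mn; rewrite -(fintype.card_image (can_inj (resizeK mn))).
apply: subset_leq_card; apply/fintype.subsetP => g /fintype.imageP[f]; rewrite !inE => Pf ->.
by have E := mult_resize_widen f mn; rewrite (admissible_congr E) (weight_congr E).
Qed.

(** * Generating function of the partitions in a finite box *)

Section BoxGeneratingFunction.
Variables (K : comNzRingType) (w q : K).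

Definition local_sum n s c i : K :=
  \sum_(m < n.+1 | allowed s c i m) w ^+ (~~ odd i * m) * q ^+ (m * i).

Lemma allowed_uniq n (f : colmult n) s t :
  odd s -> odd t -> (forall c i, allowed s c i (mult f c i)) ->
  (forall c i, allowed t c i (mult f c i)) -> s = t.
Proof.
move=> os ot Hs Ht; have := Hs true t; have := Ht true s.
have := Hs true s; have := Ht true t; rewrite /allowed !ltnn !eqxx /=.
by move=> /eqP-> /eqP->; case: ltngtP.
Qed.

(** An admissible [f] belongs to the family of exactly one [s], its smallest part. For fixed [s] the
    multiplicities are chosen independently, so the sum over a family distributes into a product of
    local sums. *)
Lemma box_product n :
  \sum_(f : colmult n | admissible f) w ^+ num_even_parts f * q ^+ weight f =
  \sum_(s < n.+1 | odd s) \prod_(c : color) \prod_(i < n.+1) local_sum n s c i.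
Proof.
pose fam (s : 'I_n.+1) (x : color * 'I_n.+1) : pred 'I_n.+1 := fun m => allowed s x.1 x.2 m.
transitivity (\sum_(s < n.+1 | odd s) \sum_(f : colmult n | f \in family (fam s))
    w ^+ num_even_parts f * q ^+ weight f); last first.
  apply: eq_bigr => s _; rewrite pair_big /=.
  rewrite (bigA_distr_big_dep (fam s)
    (fun (x : color * 'I_n.+1) (m : 'I_n.+1) => w ^+ (~~ odd x.2 * m) * q ^+ (m * x.2))) /=.
  apply: eq_bigr => f _; rewrite big_split /= !prodrXr; congr (_ ^+ _ * _ ^+ _).
    rewrite /num_even_parts pair_big_dep /= [LHS]big_mkcond /=.
    by apply: eq_bigr => -[c i] _ /=; case: odd; rewrite /= ?mul1n.
  by rewrite /weight pair_big /=; apply: eq_bigr => -[c i].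
have famP s f : reflect (forall c i, allowed (s : 'I_n.+1) c i (mult f c i)) (f \in family (fam s)).
  apply: (iffP familyP) => [H c i|H [c i]]; last by have := H c i; rewrite mult_ord.
  case: (leqP i n) => [ile|ni].
    have := H (c, Ordinal (ile : (i < n.+1)%N)); rewrite unfold_in /fam /=.
    by rewrite -(mult_ord f c (Ordinal (ile : (i < n.+1)%N))).
  have sn := ltn_ord s; rewrite mult_gt // /allowed; case: ltnP => // _.
  case: eqP => [E|_]; first by move: sn ni; rewrite E ltnS; case: ltnP.
  by case: odd => //; case: ifP.
rewrite [RHS](exchange_big_dep xpredT) //= [LHS]big_mkcond /=; apply: eq_bigr => f _.
case: ifP => [/admissibleP[s [os Hs]]|/negP af]; last first.
  by rewrite big_pred0 // => s; apply/negP => /andP[os /famP Hs]; apply/af/admissibleP; exists s.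
have sn : (s < n.+1)%N.
  rewrite ltnNge; apply/negP => /(mult_gt f true) f0.
  by have := Hs true s; rewrite f0 /allowed ltnn eqxx.
rewrite (big_pred1 (Ordinal sn)) // => t; apply/idP/eqP => [/andP[ot /famP Ht]|->].
  by apply/ord_inj/(allowed_uniq ot os Ht Hs).
by rewrite os; apply/famP.
Qed.

Definition geom n i : K := \sum_(m < n.+1) q ^+ (m * i).

Lemma local_sum_any n s c i : (forall m, allowed s c i m) -> odd i ->
  local_sum n s c i = geom n i.
Proof. by move=> H oi; apply: eq_big => m *; rewrite ?H // oi mul1r. Qed.

Lemma local_sum_only n s c i k : (k <= n)%N -> (forall m, allowed s c i m = (m == k)) ->
  local_sum n s c i = w ^+ (~~ odd i * k) * q ^+ (k * i).
Proof.
move=> kn H; by rewrite /local_sum (big_pred1 (Ordinal (kn : (k < n.+1)%N))).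
Qed.

Lemma local_sum_le1 n s c i : (0 < n)%N -> (forall m, allowed s c i m = (m <= 1)%N) -> ~~ odd i ->
  local_sum n s c i = 1 + w * q ^+ i.
Proof.
case: n => // n _ H oi; rewrite /local_sum; under eq_bigl do rewrite H.
rewrite big_mkcond 2!big_ord_recl /= big1 ?addr0; last by [].
by rewrite oi muln0 mul1r /= !mul1n.
Qed.

Lemma big_parity (F : nat -> K) L :
  \prod_(i < L.*2.+1) F i = (\prod_(j < L) F j.*2.+1) * \prod_(j < L.+1) F j.*2.
Proof.
elim: L => [|L IH]; first by rewrite double0 !big_ord_recl !big_ord0 mul1r.
rewrite doubleS 2!big_ord_recr /= IH [in RHS]big_ord_recr [X in _ = _ * X]big_ord_recr /=.
by rewrite doubleS; ring.
Qed.

Lemma big_odd_index (F : nat -> K) L :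
  \sum_(s < L.*2.+1 | odd s) F s = \sum_(k < L) F k.*2.+1.
Proof.
elim: L => [|L IH]; first by rewrite big_ord0 big_mkcond big_ord_recl big_ord0 /= addr0.
by rewrite doubleS big_mkcond 2!big_ord_recr /= -big_mkcond odd_double /= IH addr0 big_ord_recr.
Qed.

Lemma big_ord_from (F : nat -> K) k L : (k <= L)%N ->
  \prod_(j < L) (if (j < k)%N then 1 else F j) = \prod_(k <= j < L) F j.
Proof.
move=> kL; rewrite -(big_mkord xpredT (fun j => if (j < k)%N then 1 else F j)).
rewrite (big_cat_nat (leq0n k) kL) /= big_nat big1 ?mul1r; last by move=> j /andP[_ ->].
by rewrite big_nat [RHS]big_nat; apply: eq_bigr => j /andP[kj _]; rewrite ltnNge kj.
Qed.

(* The index [k] is the smallest part [2k+1]; [g j] is the factor of the odd part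
   [2j+1] and [e j] that of the even part [2j]. *)
Definition gen (g e : nat -> K) L : K :=
  \sum_(k < L) q ^+ k.*2.+1 * (\prod_(k.+1 <= j < L) g j * \prod_(k <= j < L) g j) *
    (\prod_(k.+3 <= j < L.+1) e j * \prod_(k.+1 <= j < L.+1) e j).

Definition geom_odd L j : K := geom L.*2 j.*2.+1.
Definition even_factor j : K := 1 + w * q ^+ j.*2.

Lemma box_genE L :
  \sum_(f : colmult L.*2 | admissible f) w ^+ num_even_parts f * q ^+ weight f =
  gen (geom_odd L) even_factor L.
Proof.
rewrite box_product (big_odd_index (fun s =>
  \prod_(c : color) \prod_(i < L.*2.+1) local_sum L.*2 s c i)).
apply: eq_bigr => k _; have kL := ltn_ord k.
have L0 : (0 < L.*2)%N by lia.
rewrite big_bool /= !big_parity.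
(* Blue odd parts: [2k+1] occurs once, smaller ones never, larger ones freely. *)
have -> : \prod_(j < L) local_sum L.*2 k.*2.+1 true j.*2.+1 =
    q ^+ k.*2.+1 * \prod_(k.+1 <= j < L) geom_odd L j.
  rewrite -(big_ord_from (geom_odd L) kL) (bigD1 k) //= [X in _ = _ * X](bigD1 k) //= ltnSn mul1r.
  congr (_ * _).
    rewrite (local_sum_only (k := 1)) /= ?odd_double ?mul1r ?mul1n // => m.
    by rewrite /allowed ltnn eqxx.
  apply: eq_bigr => j; rewrite -val_eqE /= => jk; rewrite ltnS leq_eqVlt (negbTE jk) /=.
  case: ltnP => kj.
    by rewrite (local_sum_only (k := 0)) /= ?muln0 ?mul0n ?mulr1 // => m;
      rewrite /allowed ltnS ltn_double kj.
  rewrite /geom_odd local_sum_any //= ?odd_double // => m;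
    rewrite /allowed ltnS ltn_double ltnNge kj /=.
  by rewrite odd_double /=; case: eqP => // E; have /eqP[] := jk; lia.
(* Green odd parts are free from [2k+1] itself on. *)
have -> : \prod_(j < L) local_sum L.*2 k.*2.+1 false j.*2.+1 = \prod_(k <= j < L) geom_odd L j.
  rewrite -(big_ord_from _ (ltnW kL)); apply: eq_bigr => j _.
  case: ltnP => kj.
    by rewrite (local_sum_only (k := 0)) /= ?muln0 ?mul0n ?mulr1 // => m;
      rewrite /allowed ltnS ltn_double kj.
  rewrite /geom_odd local_sum_any //= ?odd_double // => m;
    rewrite /allowed ltnS ltn_double ltnNge kj /=.
  by rewrite odd_double /=; case: eqP.
have even_only c j : (forall m, allowed k.*2.+1 c j.*2 m = (m == 0)%N) -> local_sum L.*2
  k.*2.+1 c j.*2 = 1.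
  by move=> H; rewrite (local_sum_only (k := 0)) // muln0 mul0n mulr1.
have even_le1 c j : (forall m, allowed k.*2.+1 c j.*2 m = (m <= 1)%N) ->
    local_sum L.*2 k.*2.+1 c j.*2 = even_factor j.
  by move=> H; rewrite local_sum_le1 // odd_double.
have neq j : (j.*2 == k.*2.+1) = false by apply/eqP; lia.
(* Blue even parts: [2j >= (2k+1) + 4] amounts to [j >= k+3]. For [k = L-1] this range is empty and
   is treated separately. *)
have -> : \prod_(j < L.+1) local_sum L.*2 k.*2.+1 true j.*2 = \prod_(k.+3 <= j < L.+1)
  even_factor j.
  case: (leqP k.+3 L.+1) => [kL'|kL'].
    rewrite -(big_ord_from _ kL'); apply: eq_bigr => j _; case: ltnP => kj.
      apply: even_only => m; rewrite /allowed neq odd_double /=.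
      by case: ifP => // _; rewrite ifT //; lia.
    apply: even_le1 => m; rewrite /allowed neq odd_double /=.
    by rewrite !ifF //; lia.
  rewrite big_geq 1?ltnW // big1 // => j _; have jL := ltn_ord j.
  apply: even_only => m; rewrite /allowed neq odd_double /=.
  by case: ifP => // _; rewrite ifT //; lia.
have -> : \prod_(j < L.+1) local_sum L.*2 k.*2.+1 false j.*2 =
    \prod_(k.+1 <= j < L.+1) even_factor j.
  rewrite -(big_ord_from even_factor (ltnW (kL : (k.+1 < L.+1)%N))); apply: eq_bigr => j _;
    case: ltnP => kj.
    by apply: even_only => m; rewrite /allowed ifT //; lia.
  by apply: even_le1 => m; rewrite /allowed neq odd_double /= ifF //; lia.
by ring.
Qed.

End BoxGeneratingFunction.

(** * The telescoping identity *)

Section Telescoping.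
Variables (K : fieldType) (w q : K).
Hypotheses (w2 : w * w = 1) (q_odd : forall j, 1 - q ^+ j.*2.+1 != 0).

Definition inv_odd j : K := (1 - q ^+ j.*2.+1)^-1.

Let e := even_factor w q.
Let d := (1 + w * q) * (1 + w * q ^+ 3).

(** The function U of the overview at x = q^(2k), with its products cut at even parts at most [2L]
    and odd parts below [2L]. *)
Definition telescoping_term k L : K :=
  (\prod_(k <= j < L.+1) e j * \prod_(k.+2 <= j < L.+1) e j) *
  (\prod_(k <= j < L) inv_odd j * \prod_(k.+1 <= j < L) inv_odd j).

Lemma telescope_step k L : (k.+1 < L)%N ->
  q ^+ k.*2.+1 * (\prod_(k.+1 <= j < L) inv_odd j * \prod_(k <= j < L) inv_odd j) *
    (\prod_(k.+3 <= j < L.+1) e j * \prod_(k.+1 <= j < L.+1) e j) * d =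
  w * q * (telescoping_term k L - telescoping_term k.+1 L).
Proof.
move=> kL; rewrite /telescoping_term.
rewrite (big_ltn (ltnW kL)) (big_ltn kL).
rewrite (@big_ltn _ _ _ k L.+1) ?(leqW (ltnW kL)) // (@big_ltn _ _ _ k.+2 L.+1) //.
set A := \prod_(k.+2 <= j < L) _; set C := \prod_(k.+3 <= j < L.+1) _.
set D := \prod_(k.+1 <= j < L.+1) _.
have ek : e k * e k.+2 = (1 - q ^+ k.*2.+1) * (1 - q ^+ k.+1.*2.+1) + w * q ^+ k.*2 * d.
  rewrite /e /even_factor /d.
  have -> : q ^+ k.*2.+1 = q * q ^+ k.*2 by rewrite exprS.
  have -> : q ^+ k.+1.*2.+1 = q ^+ 3 * q ^+ k.*2 by rewrite -exprD; congr (_ ^+ _); lia.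
  have -> : q ^+ k.+2.*2 = q ^+ 4 * q ^+ k.*2 by rewrite -exprD; congr (_ ^+ _); lia.
  set x := q ^+ k.*2; apply/eqP; rewrite -subr_eq0; apply/eqP.
  (* The two sides differ by a multiple of [w * w - 1]. *)
  by transitivity ((w * w - 1) * (x * x * q ^+ 4 - x * q - x * q ^+ 3 - w * x * q ^+ 4));
    [ring|rewrite w2 subrr mul0r].
have -> : e k * D * (e k.+2 * C) = (e k * e k.+2) * (D * C) by ring.
rewrite ek {ek} /inv_odd; have := q_odd k; have := q_odd k.+1.
have -> : q ^+ k.*2.+1 = q * q ^+ k.*2 by rewrite exprS.
move: (q ^+ k.+1.*2.+1) (q ^+ k.*2) => b x b0 a0; set a := q * x.
(* Inserting [w * w = 1] makes the left side match the product of the outer [w * q] with the [w * x]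
   coming from [ek]. *)
transitivity ((w * w) * (q * x * (((1 - b)^-1 * A) * ((1 - a)^-1 * ((1 - b)^-1 * A))) *
  (C * D) * d)).
  by rewrite w2 mul1r.
by field; rewrite a0 b0.
Qed.

(** The step at [k] splits off [e k.+2] and [inv_odd k.+1], which lie within the truncation only for
    [k < M]; the summand [k = M] stays as a boundary term. *)
Lemma gen_telescope M :
  gen q inv_odd e M.+1 * d =
  w * q * (telescoping_term 0 M.+1 - telescoping_term M M.+1)
  + q ^+ M.*2.+1 * inv_odd M * e M.+1 * d.
Proof.
rewrite /gen big_ord_recr /= mulrDl; congr (_ + _); last first.
  by rewrite !(big_geq (leqnn _)) (big_geq (leqW (leqnn _))) !big_nat1; ring.
rewrite big_distrl /=; under eq_bigr do rewrite telescope_step ?ltnS //.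
rewrite -big_distrr /= -(big_mkord xpredT (fun k =>
  telescoping_term k M.+1 - telescoping_term k.+1 M.+1)).
congr (_ * _); rewrite -(opprK (\sum_(_ <= _ < _) _)) -sumrN.
under eq_bigr do rewrite opprB.
by rewrite telescope_sumr // opprB.
Qed.

Lemma telescope_last M : telescoping_term M M.+1 = e M * e M.+1 * inv_odd M.
Proof.
rewrite /telescoping_term (big_geq (leqnn M.+2)) (big_geq (leqnn M.+1)) big_nat1.
by rewrite big_ltn // big_nat1; ring.
Qed.

End Telescoping.

(** * Majorants *)

Section Majorants.
Variable K : numFieldType.
Implicit Types a b x : K.

(* [A] and [B - A] are meant as the values at [`|q|] of series with nonnegative
   coefficients dominating those of [a] and [b - a]. *)
Definition majorized (a b A B : K) : Prop := `|a| <= A /\ `|b - a| <= B - A.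

Lemma majorized_refl a A : `|a| <= A -> majorized a a A A.
Proof. by move=> aA; split=> //; rewrite !subrr normr0. Qed.

Lemma majorizedM a b A B a' b' A' B' :
  majorized a b A B -> majorized a' b' A' B' ->
  majorized (a * a') (b * b') (A * A') (B * B').
Proof.
move=> [aA abAB] [aA' abAB']; split; first by rewrite normrM ler_pM.
have -> : b * b' - a * a' = b * (b' - a') + (b - a) * a' by ring.
have -> : B * B' - A * A' = B * (B' - A') + (B - A) * A' by ring.
rewrite (le_trans (ler_normD _ _)) // !normrM lerD ?ler_pM //.
(* The remaining bound on b by B combines the bounds on a and on b - a. *)
rewrite -[b](subrK a) -[B](subrK A) (le_trans (ler_normD _ _)) // lerD //.
Qed.

Lemma majorizedD a b A B a' b' A' B' :
  majorized a b A B -> majorized a' b' A' B' ->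
  majorized (a + a') (b + b') (A + A') (B + B').
Proof.
move=> [aA abAB] [aA' abAB']; split; first by rewrite (le_trans (ler_normD _ _)) ?lerD.
have -> : b + b' - (a + a') = (b - a) + (b' - a') by ring.
have -> : B + B' - (A + A') = (B - A) + (B' - A') by ring.
by rewrite (le_trans (ler_normD _ _)) ?lerD.
Qed.

Lemma majorized_prod I (s : seq I) (a b A B : I -> K) :
  (forall i, majorized (a i) (b i) (A i) (B i)) ->
  majorized (\prod_(i <- s) a i) (\prod_(i <- s) b i) (\prod_(i <- s) A i) (\prod_(i <- s) B i).
Proof.
move=> H; elim: s => [|i s IH]; first by rewrite !big_nil; apply: majorized_refl; rewrite normr1.
by rewrite !big_cons; apply: majorizedM.
Qed.

Lemma majorized_sum I (s : seq I) (a b A B : I -> K) :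
  (forall i, majorized (a i) (b i) (A i) (B i)) ->
  majorized (\sum_(i <- s) a i) (\sum_(i <- s) b i) (\sum_(i <- s) A i) (\sum_(i <- s) B i).
Proof.
move=> H; elim: s => [|i s IH]; first by rewrite !big_nil; apply: majorized_refl; rewrite normr0.
by rewrite !big_cons; apply: majorizedD.
Qed.

Variables (w q : K).
Hypotheses (w1 : `|w| = 1) (q1 : `|q| < 1).
Let r := `|q|.

Lemma norm_expr_lt1 (x : K) n : `|x| < 1 -> `|x ^+ n.+1| < 1.
Proof. by move=> x1; rewrite normrX exprn_ilt1. Qed.

Lemma subr1_neq0 (x : K) : `|x| < 1 -> 1 - x != 0.
Proof. by move=> x1; rewrite subr_eq0; apply: contraTneq x1 => <-; rewrite normr1 ltxx. Qed.

Lemma geomE (x : K) n i : geom x n i * (1 - x ^+ i) = 1 - x ^+ (i * n.+1).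
Proof.
rewrite exprM -[1 - (_ ^+ _) ^+ _]opprB subrX1 -mulNr opprB mulrC; congr (_ * _).
by apply: eq_bigr => m _; rewrite mulnC exprM.
Qed.

(** The difference is the geometric tail x^(i(2L+1)) / (1 - x^i) with i = 2j+1, and |1 - q^i| is at
    least 1 - r^i. *)
Lemma majorized_geom L j :
  majorized (geom_odd q L j) (inv_odd q j) (geom_odd r L j) (inv_odd r j).
Proof.
split.
  by rewrite (le_trans (ler_norm_sum _ _ _)) // ler_sum // => m _; rewrite normrX.
have E (x : K) : `|x| < 1 ->
    inv_odd x j - geom_odd x L j = x ^+ (j.*2.+1 * L.*2.+1) / (1 - x ^+ j.*2.+1).
  move=> x1; have x0 := subr1_neq0 (norm_expr_lt1 j.*2 x1).
  apply: (mulIf x0); rewrite mulrBl geomE mulVf // mulfVK //; ring.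
rewrite !E ?normr_id // normrM normfV normrX ler_wpM2l // ?exprn_ge0 //.
rewrite lef_pV2 ?posrE; last 2 first.
- by rewrite normr_gt0 subr1_neq0 // norm_expr_lt1.
- by rewrite subr_gt0 -normrX norm_expr_lt1.
by rewrite -normrX -[X in X - _]normr1 lerB_dist.
Qed.

Lemma majorized_gen L :
  majorized (gen q (geom_odd q L) (even_factor w q) L) (gen q (inv_odd q) (even_factor w q) L)
    (gen r (geom_odd r L) (even_factor 1 r) L) (gen r (inv_odd r) (even_factor 1 r) L).
Proof.
(* Even factors are not truncated: their multiplicities 0 and 1 already fit in the box. *)
have me j : majorized (even_factor w q j) (even_factor w q j)
    (even_factor 1 r j) (even_factor 1 r j).
  by apply: majorized_refl; rewrite (le_trans (ler_normD _ _)) // normrM normrX w1 normr1.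
apply: majorized_sum => k; apply: majorizedM; last by apply: majorizedM; apply: majorized_prod.
apply: majorizedM; first by apply: majorized_refl; rewrite normrX.
by apply: majorizedM; apply: majorized_prod => j; apply: majorized_geom.
Qed.

End Majorants.

(** Cutting a geometric series after multiplicity 2L costs the factor 1 - r^(i(2L+1)), at least 1 -
    r^(2L+1). Each color has at most L odd parts, which gives the exponent 2L. *)
Lemma gen_lower (K : numFieldType) (r : K) L : 0 <= r -> r < 1 ->
  (1 - r ^+ L.*2.+1) ^+ L.*2 * gen r (inv_odd r) (even_factor 1 r) L <=
  gen r (geom_odd r L) (even_factor 1 r) L.
Proof.
move=> r0 r1; set dl := 1 - _.
have rX n : r ^+ n.+1 < 1 by rewrite exprn_ilt1.
have dl0 : 0 <= dl by rewrite subr_ge0 ltW.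
have dl1 : dl <= 1 by rewrite gerBl exprn_ge0.
have inv0 j : 0 <= inv_odd r j by rewrite invr_ge0 subr_ge0 ltW.
have e0 j : 0 <= even_factor 1 r j by rewrite addr_ge0 // mul1r exprn_ge0.
have low j : dl * inv_odd r j <= geom_odd r L j.
  rewrite ler_pdivrMr ?subr_gt0 // geomE lerD2l lerN2 mulSn exprD.
  by rewrite ler_piMr ?exprn_ge0 // exprn_ile1 // ltW.
have lowP k : dl ^+ L * \prod_(k <= j < L) inv_odd r j <= \prod_(k <= j < L) geom_odd r L j.
  apply: (@le_trans _ _ (\prod_(k <= j < L) (dl * inv_odd r j))); last first.
    by apply: ler_prod => j _; rewrite low mulr_ge0.
  rewrite big_split /= prodr_const_nat ler_wpM2r ?prodr_ge0 //.
  by rewrite ler_wiXn2l // leq_subr.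
rewrite /gen mulr_sumr ler_sum // => k _; rewrite !mulrA ler_wpM2r ?prodr_ge0 //.
rewrite ler_wpM2r ?prodr_ge0 // -[X in X <= _]mulrA.
rewrite -!mulrA [X in X <= _]mulrCA ler_wpM2l ?exprn_ge0 //.
rewrite -addnn exprD mulrACA ler_pM ?mulr_ge0 ?exprn_ge0 ?prodr_ge0 //.
Qed.

(** * Partial sums of the counting series *)

Section PartialSums.
Variable K : numFieldType.
Implicit Types w q : K.

Definition signed_count w n : K :=
  \sum_(f : colmult n | admissible f && (weight f == n)) w ^+ num_even_parts f.

Definition partial_sum w q N : K := \sum_(1 <= n < N.+1) signed_count w n * q ^+ n.

Lemma weight_gt0 n (f : colmult n) : admissible f -> (0 < weight f)%N.
Proof.
move=> /admissibleP[s [os Hs]]; apply: leq_trans (mult_le_weight f true s).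
have := Hs true s; rewrite /allowed ltnn eqxx /= => /eqP->.
by case: s os {Hs}.
Qed.

(** All coefficients are read in one common box and regrouped by weight. Weights are positive, so
    starting the sum at 1 loses nothing. *)
Lemma partial_sumE w q N m : (N <= m)%N ->
  partial_sum w q N =
  \sum_(f : colmult m | admissible f && (weight f <= N)%N) w ^+ num_even_parts f * q ^+ weight f.
Proof.
move=> Nm; rewrite /partial_sum big_add1 /= big_mkord.
under eq_bigr => n _ do
  rewrite /signed_count (@sum_admissible_resize _ _ n.+1 m n.+1) ?leqnn ?(leq_trans _ Nm) //
    big_distrl /=.
rewrite (exchange_big_dep (fun f : colmult m => admissible f && (weight f <= N)%N)) /=; last first.
  by move=> n f _ /andP[-> /eqP->] /=.
apply: eq_bigr => f /andP[af fN]; have f0 := weight_gt0 af.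
have nN : ((weight f).-1 < N)%N by rewrite prednK.
rewrite (big_pred1 (Ordinal nN)) /= ?prednK // => n.
by rewrite /= af /= -val_eqE /=; move: (weight f) f0 => t t0; apply/eqP/eqP; lia.
Qed.

(** The gap splits in two: truncated against full geometric series, handled by [majorized_gen], and
    the box partitions of weight above [N], bounded term by term at |q| and w = 1. *)
Lemma partial_sum_bound w q N : `|w| = 1 -> `|q| < 1 ->
  `|partial_sum w q N - gen q (inv_odd q) (even_factor w q) N| <=
  gen `|q| (inv_odd `|q|) (even_factor 1 `|q|) N - partial_sum 1 `|q| N.
Proof.
move=> w1 q1; have [_ H] := majorized_gen w1 q1 N.
set G := gen q (geom_odd q N) _ _ in H; set G' := gen _ (geom_odd _ _) (even_factor 1 _) N in H.
rewrite distrC -[X in X - partial_sum w q N](subrK G) -addrA (le_trans (ler_normD _ _)) //.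
rewrite -[X in _ <= X - partial_sum _ _ _](subrK G') -[X in _ <= X]addrA lerD //.
have N2 : (N <= N.*2)%N by rewrite -addnn leq_addr.
have tail w' q' : gen q' (geom_odd q' N) (even_factor w' q') N - partial_sum w' q' N =
    \sum_(f : colmult N.*2 | admissible f && ~~ (weight f <= N)%N)
      w' ^+ num_even_parts f * q' ^+ weight f.
  rewrite -box_genE (partial_sumE _ _ N2).
  by rewrite (bigID (fun f => weight f <= N)%N) /= addrC addrK.
rewrite !tail (le_trans (ler_norm_sum _ _ _)) // ler_sum // => f _.
by rewrite normrM !normrX w1.
Qed.

Lemma signed_count1 n :
  signed_count 1 n = #|[pred f : colmult n | admissible f && (weight f == n)]|%:R.
Proof. by rewrite /signed_count; under eq_bigr do rewrite expr1n; rewrite sumr_const. Qed.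

(** A box holds finitely many partitions, so a long enough partial sum counts them all; the
    comparison is made weight by weight. *)
Lemma box_le_partial_sum (r : K) m : 0 <= r ->
  exists L, gen r (geom_odd r m) (even_factor 1 r) m <= partial_sum 1 r L.
Proof.
(* The chosen length exceeds neither bound needlessly: it contains the box and reaches the largest
   weight [t] occurring in it. *)
move=> r0; pose t := \max_(f : colmult m.*2) weight f; exists (maxn m.*2 t).
rewrite -box_genE (partial_sumE _ _ (leqnn _)) (partition_big (fun f =>
  inord (weight f) : 'I_t.+1) xpredT) //=.
rewrite [leRHS](bigID (fun f => (weight f < t.+1)%N)) /= ler_wpDr ?sumr_ge0 //.
  by move=> f _; rewrite expr1n mul1r exprn_ge0.
rewrite [leRHS](partition_big (fun f => inord (weight f) : 'I_t.+1) xpredT) //=.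
apply: ler_sum => k _.
have fibre n (P : pred (colmult n)) : (forall f, P f -> weight f = k :> nat) ->
    \sum_(f | P f) 1 ^+ num_even_parts f * r ^+ weight f = #|P|%:R * r ^+ k.
  move=> H; rewrite mulr_natl -sumr_const; apply: eq_bigr => f Pf.
  by rewrite expr1n mul1r (H _ Pf).
have inordE n (f : colmult n) : (weight f < t.+1)%N ->
    (inord (weight f) == k) = (weight f == k :> nat).
  by move=> ft; rewrite -val_eqE /= inordK.
rewrite !fibre; last 2 first.
- by move=> f /andP[/andP[_ ft]]; rewrite inordE // => /eqP.
- move=> f /andP[_]; rewrite inordE ?ltnS; first by move=> /eqP.
  exact: (leq_bigmax f).
rewrite ler_wpM2r ?exprn_ge0 // ler_nat.
apply: leq_trans (leq_trans (card_admissible_resize k (leq_maxl m.*2 t)) _);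
  apply/subset_leq_card/fintype.subsetP => f; rewrite !unfold_in /=.
  by rewrite inordE ?ltnS //; exact: (leq_bigmax f).
case/andP=> -> /eqP fk /=; have kt : (k <= t)%N by rewrite -ltnS.
by rewrite inordE fk ?ltnS ?kt ?eqxx // leq_max kt orbT.
Qed.

End PartialSums.
(* [R[i]] itself carries no topology; the one of Defs is found through its
   [numFieldType] structure. *)
Local Notation C R := (R[i] : numFieldType).

(** * Limits and infinite products over the complex numbers *)

Section NumFieldLimits.
Variable K : numFieldType.
Implicit Types (f g : nat -> K) (a b : K).

Lemma cvgn_mul f g a b : f @ \oo --> a -> g @ \oo --> b ->
  (fun n => f n * g n) @ \oo --> a * b.
Proof. exact: cvgM. Qed.

Lemma cvgn_add f g a b : f @ \oo --> a -> g @ \oo --> b ->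
  (fun n => f n + g n) @ \oo --> a + b.
Proof. exact: cvgD. Qed.

Lemma cvgn_sub f g a b : f @ \oo --> a -> g @ \oo --> b ->
  (fun n => f n - g n) @ \oo --> a - b.
Proof. exact: cvgB. Qed.

Lemma cvgn_inv f a : a != 0 -> f @ \oo --> a -> (fun n => (f n)^-1) @ \oo --> a^-1.
Proof. exact: cvgV. Qed.

Lemma cvgn_cst a : (fun=> a) @ \oo --> a.
Proof. exact: cvg_cst. Qed.

Lemma cvgn_dist0 f a : f @ \oo --> a -> (fun n => `|f n - a|) @ \oo --> (0 : K).
Proof. by move=> /subr_cvg0/cvg_norm; rewrite normr0. Qed.

Lemma cvgn_unique f a b : f @ \oo --> a -> f @ \oo --> b -> a = b.
Proof. by move=> fa fb; apply: cvg_unique fb. Qed.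

Lemma cvgn_shift f a : (fun n => f n.+1) @ \oo --> a -> f @ \oo --> a.
Proof. by rewrite cvg_shiftS. Qed.

Lemma cvgn_double f a : f @ \oo --> a -> (fun n => f n.*2) @ \oo --> a.
Proof.
move=> fa; rewrite (_ : (fun n => _) = f \o muln 2); last by apply/funext => n /=; rewrite mul2n.
by apply: (@cvg_comp _ _ _ (muln 2) f) fa; apply: cvg_mulnl.
Qed.

Lemma cvgn_succ f a : f @ \oo --> a -> (fun n => f n.+1) @ \oo --> a.
Proof. by rewrite -cvg_shiftS. Qed.

End NumFieldLimits.

Arguments cvgn_cst [K] a.

Section ComplexLimits.
Variable R : realType.
Implicit Types (u : nat -> C R) (e v a b : nat -> R).

Lemma normc_real (x : R) : `|x%:C| = `|x|%:C.
Proof. by rewrite normc_def /= expr0n /= addr0 sqrtr_sqr. Qed.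

Lemma normc_le (z : R[i]) : `|z| <= (`|complex.Re z| + `|complex.Im z|)%:C.
Proof.
rewrite [in X in `|X|](complexE z) (le_trans (ler_normD _ _)) // rmorphD /= normrM !normc_real.
by rewrite normc_def /= expr0n expr1n add0r sqrtr1 mul1r.
Qed.

Lemma cvg_complex u e (l : C R) :
  (forall n, `|u n - l| <= (e n)%:C) -> e @ \oo --> (0 : R) -> u @ \oo --> l.
Proof.
move=> ue /cvgr0Pnorm_lt e0; apply/cvgrPdistC_lt => eps eps0.
have epsE : eps = (complex.Re eps)%:C by rewrite RRe_real // gtr0_real.
have r0 : 0 < complex.Re eps by move: eps0; rewrite epsE ltcR.
near=> n; rewrite (le_lt_trans (ue n)) // epsE ltcR (le_lt_trans (ler_norm _)) //.
by near: n; apply: e0.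
Unshelve. all: end_near. Qed.

Lemma cvg_Re_Im a b (x y : R) : a @ \oo --> x -> b @ \oo --> y ->
  (fun n => a n +i* b n : C R) @ \oo --> (x +i* y : C R).
Proof.
move=> ax bY; apply: (@cvg_complex _ (fun n => `|a n - x| + `|b n - y|)) => [n|].
  exact: normc_le.
by rewrite -[0]addr0; apply: cvgD; apply: cvgn_dist0.
Qed.

Lemma cvg_Re u (l : C R) : u @ \oo --> l -> (fun n => complex.Re (u n)) @ \oo --> complex.Re l.
Proof.
move=> /cvgrPdist_lt ul; apply/cvgrPdist_lt => eps eps0.
have e0 : 0 < eps%:C by rewrite ltcR.
near=> n; rewrite -ltcR.
have -> : complex.Re l - complex.Re (u n) = complex.Re (l - u n) by case: (l) (u n) => ? ? [].
rewrite (le_lt_trans (normc_ge_Re _)) //; near: n; exact: ul.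
Unshelve. all: end_near. Qed.

(** Both [v] and [a + v] are nondecreasing and bounded, and [a] is their difference. *)
Lemma is_cvg_increments_real a v M : (forall n, `|a n.+1 - a n| <= v n.+1 - v n) ->
  (forall n, v n <= M) -> cvgn a.
Proof.
move=> av vM.
have vnd : nondecreasing_seq v.
  by apply/nondecreasing_seqP => n; rewrite -subr_ge0 (le_trans _ (av n)).
have cv : cvgn v.
  by apply: nondecreasing_is_cvgn => //; exists M => _ [n _ <-].
suff cav : cvgn (a \+ v).
  rewrite (_ : a = (a \+ v) - v); first exact: is_cvgB.
  by apply/funext => n; rewrite !fctE /= addrK.
apply: nondecreasing_is_cvgn.
  apply/nondecreasing_seqP => n /=; have := av n; rewrite ler_norml => /andP[+ _]; lra.
exists (a 0%N + (M - v 0%N) + M) => _ [n _ <-] /=; apply: lerD => //.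
have : a n - a 0%N <= v n - v 0%N.
  elim: n => [|n IH]; first by rewrite !subrr.
  by have := le_trans (ler_norm _) (av n); lra.
by have := vM n; lra.
Qed.

Lemma is_cvg_increments u v M : (forall n, `|u n.+1 - u n| <= (v n.+1 - v n)%:C) ->
  (forall n, v n <= M) -> cvgn u.
Proof.
move=> uv vM.
have /cvg_ex[x ax] : cvgn (fun n => complex.Re (u n)).
  apply: is_cvg_increments_real vM => n; rewrite -lecR (le_trans _ (uv n)) //.
  apply: le_trans (normc_ge_Re _); rewrite lecR.
  by case: (u n.+1) (u n) => ? ? [].
have /cvg_ex[y ay] : cvgn (fun n => complex.Im (u n)).
  apply: is_cvg_increments_real vM => n; rewrite -lecR (le_trans _ (uv n)) //.
  (* Multiplying by i turns the imaginary part into a real part up to sign, without changing the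
     norm. *)
  have := normc_ge_Re ((u n.+1 - u n) * 'i%C); rewrite normrM.
  have -> : `|'i%C : R[i]| = 1 by rewrite normc_def /= expr0n expr1n add0r sqrtr1.
  rewrite mulr1; apply: le_trans; rewrite lecR ReiNIm normrN.
  by case: (u n.+1) (u n) => ? ? [].
apply/cvg_ex; exists (x +i* y).
by rewrite (_ : u = fun n => complex.Re (u n) +i* complex.Im (u n));
  [exact: cvg_Re_Im | apply/funext => n; case: (u n)].
Qed.

Lemma prod_1D_geom_le (A r : R) n : 0 <= A -> 0 <= r < 1 ->
  \prod_(j < n) (1 + A * r ^+ j) <= expR (A / (1 - r)).
Proof.
move=> A0 /andP[r0 r1]; apply: (@le_trans _ _ (\prod_(j < n) expR (A * r ^+ j))).
  apply: ler_prod => j _; rewrite expR_ge1Dx andbT.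
  by rewrite addr_ge0 // mulr_ge0 // exprn_ge0.
rewrite -expR_sum ler_expR -mulr_sumr ler_wpM2l // -[leRHS]mul1r ler_pdivlMr ?subr_gt0 //.
by rewrite mulrC -opprB mulNr -subrX1 opprB gerBl exprn_ge0.
Qed.

(** The increments of the product are dominated by those of the real product of the factors 1 + A
    r^j, which is bounded by an exponential. *)
Lemma is_cvg_prod_1D (c : nat -> C R) (A r : R) : 0 <= A -> 0 <= r < 1 ->
  (forall j, `|c j| <= (A * r ^+ j)%:C) -> cvgn (fun n => \prod_(j < n) (1 + c j)).
Proof.
move=> A0 r01 cA; have /andP[r0 _] := r01.
pose v n := \prod_(j < n) (1 + A * r ^+ j).
apply: (@is_cvg_increments _ v (expR (A / (1 - r)))) => n; last exact: prod_1D_geom_le.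
have -> : v n.+1 - v n = v n * (A * r ^+ n) by rewrite /v big_ord_recr /=; ring.
rewrite big_ord_recr /= mulrDr mulr1 addrAC subrr add0r normrM rmorphM /=.
apply: ler_pM => //; rewrite /v rmorph_prod /= normr_prod.
apply: ler_prod => j _; rewrite normr_ge0 /= rmorphD /=.
by rewrite (le_trans (ler_normD _ _)) // normr1 lerD.
Qed.

Lemma norm_real (z : C R) : exists2 r, `|z| = r%:C & 0 <= r.
Proof.
have E : `|z| = (complex.Re `|z|)%:C by rewrite RRe_real // normr_real.
by exists (complex.Re `|z|) => //; rewrite -ler0c -E.
Qed.

Lemma norm_lt1_real (z : C R) : `|z| < 1 -> exists2 r, `|z| = r%:C & 0 <= r < 1.
Proof.
by have [r E r0] := norm_real z; rewrite E ltcR => r1; exists r => //; apply/andP.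
Qed.

Variable q : C R.
Hypothesis q1 : `|q| < 1.

(** [qpoch] is a bare [lim], informative only once convergence is known; here the factors deviate
    from 1 by |a| r^j. *)
Lemma qpoch_cvg (a : C R) : (fun N => \prod_(j < N) (1 - a * q ^+ j)) @ \oo --> qpoch a q.
Proof.
have [r rE r01] := norm_lt1_real q1; have [s sE s0] := norm_real a.
apply: (@is_cvg_prod_1D (fun j => - (a * q ^+ j)) s r) => // j.
by rewrite normrN normrM normrX rE sE -rmorphXn -rmorphM.
Qed.

(** The reciprocals 1 / (1 - a q^j) = 1 + c_j also have a convergent product. The two partial
    products multiply to 1, so neither limit is 0. *)
Lemma qpoch_neq0 (a : C R) : `|a| < 1 -> qpoch a q != 0.
Proof.
move=> a1; have [r rE r01] := norm_lt1_real q1; have [s sE s01] := norm_lt1_real a1.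
have aq1 j : `|a * q ^+ j| < 1.
  by rewrite normrM normrX (le_lt_trans _ a1) // ler_piMr // exprn_ile1 // ltW.
have d0 j : 1 - a * q ^+ j != 0 by apply: subr1_neq0.
pose c j := a * q ^+ j / (1 - a * q ^+ j).
have /cvg_ex[l cl] : cvgn (fun n => \prod_(j < n) (1 + c j)).
  have /andP[r0 rlt1] := r01; have /andP[s0 s1] := s01.
  apply: (@is_cvg_prod_1D _ (s / (1 - s)) r) => // [|j].
    by rewrite divr_ge0 // subr_ge0 ltW.
  rewrite mulrAC fmorph_div rmorphB rmorph1 rmorphM rmorphXn /= -sE -rE.
  rewrite normrM normfV -normrX -normrM ler_wpM2l //.
  rewrite lef_pV2 ?posrE ?normr_gt0 // ?subr_gt0 //.
  rewrite (le_trans _ (lerB_dist _ _)) // normr1 lerD2l lerN2 normrM normrX.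
  by rewrite ler_piMr // exprn_ile1 // ltW.
apply/eqP => p0.
have : (fun n => (\prod_(j < n) (1 - a * q ^+ j)) * \prod_(j < n) (1 + c j)) @ \oo -->
    qpoch a q * l.
  by apply: cvgn_mul cl; apply: qpoch_cvg.
rewrite p0 mul0r (_ : (fun n => _) = fun=> 1); last first.
  apply/funext => n; rewrite -big_split /= big1 // => j _.
  by rewrite mulrDr mulr1 /c [X in _ + X]mulrC divfK // addrNK.
by move=> /(cvgn_unique (cvgn_cst (1 : C R)))/eqP; rewrite oner_eq0.
Qed.

End ComplexLimits.

Arguments qpoch_cvg [R q] q1 a.

(** * Functional equations of the q-Pochhammer symbol *)

Section QPochhammer.
Variables (R : realType) (q : C R).
Hypothesis q1 : `|q| < 1.

Let q2 : `|q ^+ 2| < 1.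
Proof. by rewrite normrX expr_lt1. Qed.

Lemma qpoch_rec (a : C R) : qpoch a q = (1 - a) * qpoch (a * q) q.
Proof.
apply: (cvgn_unique (cvgn_succ (qpoch_cvg q1 a))).
rewrite (_ : (fun n => _) = fun n => (1 - a) * \prod_(j < n) (1 - a * q * q ^+ j)).
  by apply: cvgn_mul (cvgn_cst _) _; apply: qpoch_cvg.
apply/funext => n; rewrite big_ord_recl /= expr0 mulr1; congr (_ * _).
by apply: eq_bigr => j _; rewrite exprS mulrA.
Qed.

Lemma qpoch_split (a : C R) : qpoch a q = qpoch a (q ^+ 2) * qpoch (a * q) (q ^+ 2).
Proof.
apply: (cvgn_unique (cvgn_double (qpoch_cvg q1 a))).
rewrite (_ : (fun n => _) = fun n => (\prod_(j < n) (1 - a * (q ^+ 2) ^+ j)) *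
  \prod_(j < n) (1 - a * q * (q ^+ 2) ^+ j)).
  by apply: cvgn_mul; apply: qpoch_cvg.
apply/funext => n; elim: n => [|n IH]; first by rewrite !big_ord0 mulr1.
rewrite doubleS !big_ord_recr /= IH -!exprM mul2n -(mulrA a) -exprS.
by rewrite mulrACA mulrA.
Qed.

Lemma qpoch_sqr (a : C R) : qpoch (a ^+ 2) (q ^+ 2) = qpoch a q * qpoch (- a) q.
Proof.
apply: (cvgn_unique (qpoch_cvg q2 (a ^+ 2))).
rewrite (_ : (fun n => _) = fun n => (\prod_(j < n) (1 - a * q ^+ j)) *
  \prod_(j < n) (1 - (- a) * q ^+ j)).
  by apply: cvgn_mul; apply: qpoch_cvg.
apply/funext => n; rewrite -big_split /=; apply: eq_bigr => j _.
by rewrite exprAC -exprMn mulNr opprK mulrC -subr_sqr expr1n.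
Qed.

End QPochhammer.

(** * Passage to the limit *)

Section RealSequences.
Variable R : realType.
Implicit Types (r : R) (s g d : nat -> R).

Lemma cvg_natmul_expr r : 0 <= r < 1 -> (fun n => n%:R * r ^+ n) @ \oo --> (0 : R).
Proof.
case/andP=> r0 r1; apply: cvg_series_cvg_0.
(* Closed form of the partial sums, which bounds the series by r / (1 - r)^2; its terms therefore
   tend to 0. *)
have E n : (1 - r) ^+ 2 * series (fun n => n%:R * r ^+ n) n = r - r ^+ n * (n%:R * (1 - r) + r).
  elim: n => [|n IH]; first by rewrite /series /= big_geq //; ring.
  by rewrite seriesSr /= mulrDr IH [r ^+ n.+1]exprS -natr1; ring.
apply: nondecreasing_is_cvgn.
  apply/nondecreasing_seqP => n; rewrite [leRHS]seriesSr lerDl.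
  by rewrite mulr_ge0 ?exprn_ge0.
have d0 : 0 < (1 - r) ^+ 2 by rewrite exprn_gt0 // subr_gt0.
exists (r / (1 - r) ^+ 2) => _ [n _ <-]; rewrite ler_pdivlMr // mulrC E gerBl.
by rewrite mulr_ge0 ?exprn_ge0 // addr_ge0 // mulr_ge0 // subr_ge0 ltW.
Qed.

(** Monotonicity puts every [s m] below the limit of [s], so [m] may depend on [n] in any way: c =
    lim d g <= lim s <= lim g = c. *)
Lemma cvg_squeeze_sup s g d (c : R) : nondecreasing_seq s ->
  (forall n, s n <= g n) -> g @ \oo --> c -> d @ \oo --> (1 : R) ->
  (forall n, exists m, d n * g n <= s m) -> s @ \oo --> c.
Proof.
move=> snd sg gc d1 dgs.
have cs : cvgn s.
  apply: nondecreasing_is_cvgn => //.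
  have [M gM] := cvg_has_ub (cvgP _ gc); exists M => _ [n _ <-].
  by rewrite (le_trans (sg n)) // (le_trans (ler_norm _)) // gM //; exists n.
suff -> : c = limn s by [].
apply/eqP; rewrite eq_le; apply/andP; split.
  have : (fun n => d n * g n) @ \oo --> c by rewrite -[c]mul1r; apply: cvgM.
  move=> /cvg_lim <- //; apply: limr_le; first by apply: cvgP; apply: cvgM d1 gc.
  near=> n; have [m /le_trans] := dgs n; apply; exact: nondecreasing_cvgn_le.
rewrite -(cvg_lim _ gc) //; apply: ler_lim => //; first exact: cvgP gc.
by near=> n.
Unshelve. all: end_near. Qed.

End RealSequences.

Arguments cvg_squeeze_sup [R s g] d [c].

Lemma bernoulli_1B (K : numFieldType) (x : K) n : 0 <= x <= 1 -> 1 - n%:R * x <= (1 - x) ^+ n.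
Proof.
move=> /andP[x0 x1]; elim: n => [|n IH]; first by rewrite mul0r subr0.
have d0 : 0 <= 1 - x by rewrite subr_ge0.
rewrite exprS (le_trans _ (ler_wpM2l d0 IH)) // -subr_ge0.
have -> : (1 - x) * (1 - n%:R * x) - (1 - n.+1%:R * x) = n%:R * (x * x) by rewrite -natr1; ring.
by rewrite mulr_ge0 // mulr_ge0.
Qed.

Section Limits.
Variables (R : realType) (w q : C R).
Hypotheses (q1 : `|q| < 1) (w1 : `|w| = 1) (w2 : w * w = 1).

Let q_neq1 j : 1 - q ^+ j.+1 != 0.
Proof. exact: subr1_neq0 (norm_expr_lt1 _ q1). Qed.

Let wq_neq0 j : 1 + w * q ^+ j.+1 != 0.
Proof.
by rewrite -[w]opprK mulNr subr1_neq0 // normrM normrN w1 mul1r norm_expr_lt1.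
Qed.

Lemma cvg_cexpr : (fun n => q ^+ n) @ \oo --> (0 : C R).
Proof.
have [r rE r01] := norm_lt1_real q1.
apply: (cvg_complex (e := fun n => r ^+ n)) => [n|].
  by rewrite subr0 normrX rE rmorphXn.
by case/andP: r01 => r0 r1; apply: cvg_expr; rewrite ger0_norm.
Qed.

Let q2 : `|q ^+ 2| < 1.
Proof. exact: norm_expr_lt1. Qed.

(** This is w q (U(1) - 1) / ((1 + wq)(1 + wq^3)). The first factor 1 + w of (-w; q^2) is pulled
    out, so that U(1) visibly vanishes at w = -1. *)
Definition gen_limit : C R :=
  w * q / ((1 + w * q) * (1 + w * q ^+ 3)) *
  ((1 + w) * qpoch (- (w * q ^+ 2)) (q ^+ 2) * qpoch (- (w * q ^+ 4)) (q ^+ 2)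
    / (qpoch q (q ^+ 2) * qpoch (q ^+ 3) (q ^+ 2)) - 1).

Lemma cvg_even_factor : (fun M => even_factor w q M) @ \oo --> (1 : C R).
Proof.
rewrite -[X in _ --> X]addr0; apply: cvgn_add (cvgn_cst _) _.
rewrite -[X in _ --> X](mulr0 w); apply: cvgn_mul (cvgn_cst _) _.
exact: cvgn_double cvg_cexpr.
Qed.

Lemma cvg_inv_odd : (fun M => inv_odd q M) @ \oo --> (1 : C R).
Proof.
rewrite -[X in _ --> X]invr1; apply: cvgn_inv; first exact: oner_neq0.
rewrite -[X in _ --> X]subr0; apply: cvgn_sub (cvgn_cst _) _.
exact: cvgn_double (cvgn_succ cvg_cexpr).
Qed.

Lemma cvg_prod_even (k : nat) :
  (fun M => \prod_(k <= j < M + k) even_factor w q j) @ \oo -->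
  qpoch (- (w * q ^+ k.*2)) (q ^+ 2).
Proof.
rewrite (_ : (fun _ => _) = fun M => \prod_(j < M) (1 - (- (w * q ^+ k.*2)) * (q ^+ 2) ^+ j)).
  exact: qpoch_cvg.
apply/funext => M; rewrite -{1}[k]add0n big_addn addnK big_mkord; apply: eq_bigr => j _.
by rewrite mulNr opprK -mulrA -exprM -exprD /even_factor doubleD addnC mul2n.
Qed.

Arguments cvg_prod_even : clear implicits.

Lemma cvg_prod_odd (k : nat) :
  (fun M => \prod_(k <= j < M + k) inv_odd q j) @ \oo -->
  (qpoch (q ^+ k.*2.+1) (q ^+ 2))^-1.
Proof.
rewrite (_ : (fun _ => _) = fun M => (\prod_(j < M) (1 - q ^+ k.*2.+1 * (q ^+ 2) ^+ j))^-1).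
  apply: cvgn_inv; last exact: qpoch_cvg.
  by apply: qpoch_neq0; [exact: q2 | exact: norm_expr_lt1].
apply/funext => M; rewrite -{1}[k]add0n big_addn addnK big_mkord -prodfV; apply: eq_bigr => j _.
by rewrite -exprM -exprD /inv_odd doubleD -addnS addnC mul2n.
Qed.

Arguments cvg_prod_odd : clear implicits.

Lemma gen_cvg : (fun N => gen q (inv_odd q) (even_factor w q) N) @ \oo --> gen_limit.
Proof.
pose d := (1 + w * q) * (1 + w * q ^+ 3).
have d0 : d != 0 by rewrite mulf_neq0 ?wq_neq0 //; have := wq_neq0 0; rewrite expr1.
apply: cvgn_shift.
rewrite (_ : (fun n => _) = fun M =>
  w * q / d * (telescoping_term w q 0 M.+1 - telescoping_term w q M M.+1) +
  q ^+ M.*2.+1 * inv_odd q M * even_factor w q M.+1); last first.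
  apply/funext => M; apply: (mulIf d0); rewrite gen_telescope // [RHS]mulrDl; congr (_ + _).
  by rewrite [RHS]mulrAC divfK.
rewrite -[gen_limit]addr0; apply: cvgn_add.
  rewrite /gen_limit; apply: cvgn_mul (cvgn_cst _) _; apply: cvgn_sub.
    rewrite /telescoping_term invfM; apply: cvgn_mul; apply: cvgn_mul.
    - have -> : 1 + w = even_factor w q 0 by rewrite /even_factor expr0 mulr1.
      rewrite (_ : (fun n => _) = fun M => even_factor w q 0 *
          \prod_(1 <= j < M.+1 + 1) even_factor w q j).
        by apply: cvgn_mul (cvgn_cst _) _; apply: cvgn_succ (cvg_prod_even 1).
      by apply/funext => M; rewrite big_ltn // addn1.
    - rewrite (_ : (fun n => _) = fun M => \prod_(2 <= j < M + 2) even_factor w q j).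
        exact: cvg_prod_even 2.
      by apply/funext => M; rewrite addn2.
    - rewrite (_ : (fun n => _) = fun M => \prod_(0 <= j < M.+1 + 0) inv_odd q j).
        by apply: cvgn_succ (cvg_prod_odd 0).
      by apply/funext => M; rewrite addn0.
    - rewrite (_ : (fun n => _) = fun M => \prod_(1 <= j < M + 1) inv_odd q j).
        exact: cvg_prod_odd 1.
      by apply/funext => M; rewrite addn1.
  (* The last telescoping term has three factors, each tending to 1; this is the 1 subtracted in
     [gen_limit]. *)
  rewrite (_ : (fun n => _) = fun M => even_factor w q M * even_factor w q M.+1 * inv_odd q M).
    rewrite -[X in _ --> X]mulr1; apply: cvgn_mul cvg_inv_odd.
    rewrite -[X in _ --> X]mulr1; apply: cvgn_mul cvg_even_factor _.
    exact: cvgn_succ cvg_even_factor.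
  by apply/funext => M; rewrite telescope_last.
rewrite -[X in _ --> X](mul0r (1 : C R)); apply: cvgn_mul; last exact: cvgn_succ cvg_even_factor.
rewrite -[X in _ --> X](mul0r (1 : C R)); apply: cvgn_mul cvg_inv_odd.
exact: cvgn_double (cvgn_succ cvg_cexpr).
Qed.

End Limits.

Section PartialSumLimit.
Variables (R : realType) (w q : C R).
Hypotheses (q1 : `|q| < 1) (w1 : `|w| = 1) (w2 : w * w = 1).

Lemma gen_real (r : R) (N : nat) :
  gen (r%:C : C R) (inv_odd (r%:C : C R)) (even_factor 1 (r%:C : C R)) N =
  (gen r (inv_odd r) (even_factor 1 r) N)%:C.
Proof.
rewrite /gen rmorph_sum; apply: eq_bigr => k _.
rewrite !rmorphM !rmorph_prod rmorphXn /=.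
by congr (_ * (_ * _) * (_ * _)); apply: eq_bigr => j _;
  rewrite /inv_odd /even_factor ?fmorphV ?rmorphB ?rmorphD ?rmorphM ?rmorphXn ?rmorph1.
Qed.

Lemma partial_sum_real (r : R) (N : nat) :
  partial_sum 1 (r%:C : C R) N = (partial_sum 1 r N)%:C.
Proof.
rewrite /partial_sum rmorph_sum; apply: eq_bigr => n _.
by rewrite !signed_count1 rmorphM rmorphXn /= rmorph_nat.
Qed.

Lemma partial_sum_real_cvg (r : R) : 0 <= r < 1 ->
  (fun N => partial_sum 1 r N) @ \oo --> complex.Re (gen_limit (1 : C R) (r%:C : C R)).
Proof.
move=> r01; have /andP[r0 r1] := r01.
have nE : `|r%:C : C R| = r%:C by rewrite normc_real ger0_norm.
have nr : `|r%:C : C R| < 1 by rewrite nE ltcR.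
have Gc := cvg_Re (gen_cvg nr (normr1 _) (mulr1 _)).
have {}Gc : (fun N => gen r (inv_odd r) (even_factor 1 r) N) @ \oo -->
    complex.Re (gen_limit (1 : C R) (r%:C : C R)).
  by move: Gc; under eq_fun do rewrite gen_real.
(* The chosen sequence is Bernoulli's lower bound for (1 - r^(2N+1))^(2N), the factor of
   [gen_lower]; it tends to 1 because n r^n tends to 0. *)
apply: (cvg_squeeze_sup (fun N => 1 - N.*2%:R * r ^+ N.*2 * r) _ _ Gc).
- apply/nondecreasing_seqP => N; rewrite /partial_sum [leRHS]big_nat_recr //= lerDl.
  by rewrite signed_count1 mulr_ge0 // exprn_ge0.
(* The right side of [partial_sum_bound] dominates a norm, hence is nonnegative. *)
- move=> N; rewrite -lecR -subr_ge0.
  have := partial_sum_bound N (normr1 _) nr; rewrite nE gen_real !partial_sum_real.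
  by move=> H; apply: le_trans (normr_ge0 _) H.
- rewrite -[X in _ --> X]subr0; apply: cvgn_sub (cvgn_cst _) _.
  rewrite -[X in _ --> X](mul0r r); apply: cvgn_mul (cvgn_cst _).
  exact: cvgn_double (cvg_natmul_expr r01).
- move=> N; have [L GL] := box_le_partial_sum N r0; exists L; apply: le_trans GL.
  apply: le_trans (gen_lower N r0 r1); apply: ler_wpM2r.
    have i0 j : 0 <= inv_odd r j by rewrite invr_ge0 subr_ge0 exprn_ile1 // ltW.
    have e0 j : 0 <= even_factor 1 r j by rewrite addr_ge0 // mul1r exprn_ge0.
    by apply: sumr_ge0 => k _; rewrite !mulr_ge0 ?exprn_ge0 ?prodr_ge0.
  rewrite -mulrA -exprSr; apply: bernoulli_1B.
  by rewrite exprn_ge0 //= exprn_ile1 // ltW.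
Qed.

(** At r = |q| and w = 1 the partial sums and [gen] have the same limit, so their gap tends to 0; it
    dominates the gap at [q] and [w]. *)
Lemma partial_sum_cvg : (fun N => partial_sum w q N) @ \oo --> gen_limit w q.
Proof.
have [r rE r01] := norm_lt1_real q1; have /andP[r0 r1] := r01.
have nr : `|r%:C : C R| < 1 by rewrite -rE normr_id.
pose e N := gen r (inv_odd r) (even_factor 1 r) N - partial_sum 1 r N.
have e0 : e @ \oo --> (0 : R).
  rewrite -[X in _ --> X](subrr (complex.Re (gen_limit (1 : C R) (r%:C : C R)))).
  apply: cvgn_sub (partial_sum_real_cvg r01).
  have := cvg_Re (gen_cvg nr (normr1 _) (mulr1 _)).
  by under eq_fun do rewrite gen_real.
have dZ : (fun N => partial_sum w q N - gen q (inv_odd q) (even_factor w q) N) @ \oo --> (0 : C R).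
  apply: (cvg_complex _ e0) => N; rewrite subr0 (le_trans (partial_sum_bound N w1 q1)) //.
  by rewrite rE gen_real partial_sum_real -rmorphB.
rewrite (_ : (fun N => _) = fun N => (partial_sum w q N - gen q (inv_odd q) (even_factor w q) N)
   + gen q (inv_odd q) (even_factor w q) N); last by apply/funext => N; rewrite subrK.
by rewrite -[gen_limit w q]add0r; apply: cvgn_add dZ (gen_cvg q1 w1 w2).
Qed.

End PartialSumLimit.

(** * The series with coefficients floor((n+2)/3) *)

Lemma floor_sum (K : comNzRingType) (q : K) (N : nat) :
  (1 - q) * (1 - q ^+ 3) * \sum_(1 <= n < N.+1) ((n + 2) %/ 3)%N%:R * q ^+ n =
  q - q ^+ (3 * ((N + 2) %/ 3)).+1 - (1 - q ^+ 3) * (((N + 2) %/ 3)%N%:R * q ^+ N) * q.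
Proof.
elim: N => [|N IH]; first by rewrite big_geq // divn_small // muln0; ring.
rewrite big_nat_recr //= mulrDr IH [q ^+ N.+1]exprS.
(* The floor jumps by one exactly in passing from a multiple of 3 to its successor; otherwise it is
   constant. *)
have [E|[E F]] : ((N.+1 + 2) %/ 3 = (N + 2) %/ 3 \/
    (N.+1 + 2) %/ 3 = ((N + 2) %/ 3).+1 /\ N = 3 * ((N + 2) %/ 3))%N by lia.
  by rewrite E; ring.
by rewrite E mulnS -!natr1 -F [q ^+ N.+1]exprS [q ^+ (3 + N).+1]exprS exprD; ring.
Qed.

Lemma floor_cvg (R : realType) (q : C R) : `|q| < 1 ->
  sums_from1 (fun n => ((n + 2) %/ 3)%N%:R * q ^+ n) (q / ((1 - q) * (1 - q ^+ 3))).
Proof.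
move=> q1; have d0 : (1 - q) * (1 - q ^+ 3) != 0.
  by rewrite mulf_neq0 ?subr1_neq0 // norm_expr_lt1.
have [r rE r01] := norm_lt1_real q1; have /andP[r0 r1] := r01.
have f0 : (fun N => ((N + 2) %/ 3)%N%:R * q ^+ N) @ \oo --> (0 : C R).
  apply: (cvg_complex _ (cvg_natmul_expr r01)) => N.
  rewrite subr0 normrM normrX rE normr_nat rmorphM rmorphXn rmorph_nat ler_wpM2r //.
    by rewrite exprn_ge0 // -rE.
  by rewrite ler_nat; lia.
(* The exponent is at least [N], since 3 floor((N+2)/3) >= N. *)
have g0 : (fun N => q ^+ (3 * ((N + 2) %/ 3)).+1) @ \oo --> (0 : C R).
  apply: (cvg_complex (e := fun n => r ^+ n)) => [N|]; last first.
    by apply: cvg_expr; rewrite ger0_norm.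
  rewrite subr0 normrX rE -rmorphXn lecR ler_wiXn2l ?(ltW r1) //; lia.
rewrite /sums_from1 (_ : (fun N => _) = fun N => (q - q ^+ (3 * ((N + 2) %/ 3)).+1 -
  (1 - q ^+ 3) * (((N + 2) %/ 3)%N%:R * q ^+ N) * q) * ((1 - q) * (1 - q ^+ 3))^-1); last first.
  by apply/funext => N; rewrite -floor_sum mulrC mulKf.
apply: cvgn_mul (cvgn_cst _).
have := cvgn_mul (cvgn_mul (cvgn_cst (1 - q ^+ 3)) f0) (cvgn_cst q).
by move=> /(cvgn_sub (cvgn_sub (cvgn_cst q) g0)); rewrite mulr0 mul0r !subr0.
Qed.

(** * From the counts to the closed forms *)

Lemma B_count (K : numFieldType) (n : nat) : (B n)%:R = signed_count (1 : K) n.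
Proof.
rewrite signed_count1; congr (_%:R); apply: eq_card => f; rewrite !inE /two_color_partition.
by rewrite /admissible andbAC.
Qed.

Lemma B'_count (K : numFieldType) (n : nat) : (B' n)%:~R = signed_count (-1 : K) n.
Proof.
rewrite /signed_count (bigID (fun f => ~~ odd (num_even_parts f))) /=.
under eq_bigr => f /andP[_ /negbTE fo] do rewrite -signr_odd fo expr0.
under [X in _ = _ + X]eq_bigr => f /andP[_ /negPn fo] do rewrite -signr_odd fo expr1.
rewrite !sumr_const mulNrn /B' rmorphB /= -!pmulrn; congr (_%:R - _%:R); apply: eq_card => f;
  rewrite !inE /two_color_partition /admissible unfold_in /= ?negbK.
  by case: [forall c, _]; case: (B_admissible f); case: (_ == n).
by case: [forall c, _]; case: (B_admissible f); case: (_ == n).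
Qed.

Lemma sums_from1_B (R : realType) (q : C R) : `|q| < 1 ->
  sums_from1 (fun n => (B n)%:R * q ^+ n) (gen_limit 1 q).
Proof.
move=> q1; rewrite /sums_from1.
under eq_fun do under eq_bigr do rewrite B_count.
by apply: partial_sum_cvg => //; rewrite ?normr1 ?mulr1.
Qed.

Lemma sums_from1_B' (R : realType) (q : C R) : `|q| < 1 ->
  sums_from1 (fun n => (B' n)%:~R * q ^+ n) (gen_limit (-1) q).
Proof.
move=> q1; rewrite /sums_from1.
under eq_fun do under eq_bigr do rewrite B'_count.
by apply: partial_sum_cvg => //; rewrite ?normrN1 ?mulrNN ?mulr1.
Qed.

(** Everything is brought to base q^2. Squaring gives (q^2; q^4) = (q; q^2)(-q; q^2) and (q^6; q^4)
    = (q^3; q^2)(-q^3; q^2); removing the first factors 1 + q and 1 + q^3 leaves (-q^3; q^2) and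
    (-q^5; q^2), which cancel against the numerators. *)
Lemma gen_limit1 (R : realType) (q : C R) : `|q| < 1 ->
  gen_limit 1 q =
  2 * q * qpoch (- q ^+ 2) q * qpoch (- q ^+ 4) q
      / (qpoch (q ^+ 2) (q ^+ 4) * qpoch (q ^+ 6) (q ^+ 4)) - q / ((1 + q) * (1 + q ^+ 3)).
Proof.
move=> q1; have nX k : `|q ^+ k.+1| < 1 by apply: norm_expr_lt1.
have nNX k : `|- q ^+ k.+1| < 1 by rewrite normrN.
have nz k : 1 + q ^+ k.+1 != 0 by rewrite -[q ^+ _]opprK subr1_neq0.
have d1 : 1 + q != 0 by have := nz 0; rewrite expr1.
have d3 := nz 2; have Q1 := nX 1.
have E1 : qpoch (- q ^+ 2) q = qpoch (- q ^+ 2) (q ^+ 2) * qpoch (- q ^+ 3) (q ^+ 2).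
  by rewrite (qpoch_split q1) mulNr -exprSr.
have E2 : qpoch (- q ^+ 4) q = qpoch (- q ^+ 4) (q ^+ 2) * qpoch (- q ^+ 5) (q ^+ 2).
  by rewrite (qpoch_split q1) mulNr -exprSr.
have E3 : qpoch (q ^+ 2) (q ^+ 4) =
    qpoch q (q ^+ 2) * ((1 + q) * qpoch (- q ^+ 3) (q ^+ 2)).
  by rewrite (exprM q 2 2) (qpoch_sqr Q1) (qpoch_rec Q1 (- q)) opprK mulNr -exprS.
have E4 : qpoch (q ^+ 6) (q ^+ 4) =
    qpoch (q ^+ 3) (q ^+ 2) * ((1 + q ^+ 3) * qpoch (- q ^+ 5) (q ^+ 2)).
  by rewrite (exprM q 2 2) (exprM q 3 2) (qpoch_sqr Q1) (qpoch_rec Q1 (- q ^+ 3)) opprK mulNr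
    -exprD.
rewrite E1 E2 E3 E4 /gen_limit !mul1r.
have := qpoch_neq0 Q1 q1; have := qpoch_neq0 Q1 (nX 2).
have := qpoch_neq0 Q1 (nNX 2); have := qpoch_neq0 Q1 (nNX 4).
move: (qpoch q _) (qpoch (q ^+ 3) _) (qpoch (- q ^+ 3) _) (qpoch (- q ^+ 5) _).
move=> C1 C3 B3 B5 ? ? ? ?; field; do !(apply/andP; split) => //.
Qed.

Theorem theorem6 (R : realType) (q : R[i]) (hq : `|q| < 1) :
  let P : R[i] :=
    2 * q * qpoch (- q ^+ 2) q * qpoch (- q ^+ 4) q
      / (qpoch (q ^+ 2) (q ^+ 4) * qpoch (q ^+ 6) (q ^+ 4)) in
  (sums_from1 (fun n => (B n)%:R * q ^+ n)
     (P - q / ((1 + q) * (1 + q ^+ 3))) /\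
   exists S : R[i],
     sums_from1 (fun n => (-1) ^+ n * ((n + 2) %/ 3)%N%:R * q ^+ n) S /\
     P - q / ((1 + q) * (1 + q ^+ 3)) = P + S) /\
  (sums_from1 (fun n => (B' n)%:~R * q ^+ n)
     (q / ((1 - q) * (1 - q ^+ 3))) /\
   sums_from1 (fun n => ((n + 2) %/ 3)%N%:R * q ^+ n)
     (q / ((1 - q) * (1 - q ^+ 3)))).
Proof.
move=> P; have nN : `|- q : C R| < 1 by rewrite normrN.
have B_sum := sums_from1_B hq; rewrite (gen_limit1 hq) in B_sum.
have B'_sum := sums_from1_B' hq.
(* The alternating series is the floor series evaluated at [- q]. *)
have floorN : sums_from1 (fun n => (-1) ^+ n * ((n + 2) %/ 3)%N%:R * q ^+ n : C R)
    (- (q / ((1 + q) * (1 + q ^+ 3)))).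
  have := floor_cvg nN.
  rewrite opprK mulNr exprNn -[3%N]/(2.+1) exprS sqrrN expr1n mulr1 mulN1r opprK.
  by rewrite /sums_from1; under eq_fun do under eq_bigr do rewrite exprNn mulrCA mulrA.
split; split; first exact: B_sum.
- by exists (- (q / ((1 + q) * (1 + q ^+ 3)))); split.
(* At w = -1 the factor 1 + w kills U(1), leaving only the prefactor times -1. *)
- by move: B'_sum; rewrite /gen_limit subrr !mul0r sub0r mulrN1 !mulN1r mulNr opprK.
- exact: floor_cvg.
Qed.
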